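(* Let $m\geq1$ and $n_1,\dots,n_m\in\mathbb{N}$. Define $U_1=(\alpha\;(x\;\lambda d\lambda y\,(y\;\widehat{n_1})\;\mathbf{id}\;\alpha))$ and $U_k=(\alpha\;(x\;\lambda d\lambda y\,(y\;\widehat{n_k})\;\mathbf{id}\;(\mathcal I\;U_{k-1})))$ for $2\le k\le m$, and let $P_{n_1,\dots,n_m}=\lambda x\,\mu\alpha\,U_m$. Then $\vdash' P_{n_1,\dots,n_m}:\forall x\,\{\mathrm{Ent}[x]\rightarrow\exists y\,\mathrm{Ent}[y]\}$ and $(P_{n_1,\dots,n_m}\;\widehat{0})\rightarrow_{\mu^{++}}\{\lambda y\,(y\;\widehat{n_i}) : 1\le i\le m\}$.
   Context: $\lambda\mu^{++}$-terms: $t ::= x\mid\alpha\mid\lambda x\,t\mid\mu\alpha\,t\mid(t\;t)$ ($x$ $\lambda$-variables, $\alpha$ $\mu$-variables; binders $\lambda,\mu$; application left-associative). $\mathbf{id}=\lambda x\,x$, $\mathcal I=\lambda x\,\mu\alpha\,x$, and $\widehat{n}=\lambda x\lambda y\,(y^n\;x)$ with $(y^0\;x)=x$, $(y^{k+1}\;x)=(y\;(y^k\;x))$. One-step reduction $\rightharpoonup$ is the contextual closure of: $(C_\lambda)$ $(\lambda x\,u\;v)\rightharpoonup u[x:=v]$; $(C_\mu)$ $(\mu\alpha\,u\;v)\rightharpoonup\mu\beta\,u[\alpha:=\lambda y\,(\beta\;(y\;v))]$; $(S_1)$ $((\alpha\;u)\;v)\rightharpoonup(\alpha\;u)$; $(S_2)$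 $\mu\alpha\mu\beta\,u\rightharpoonup\mu\alpha\,u[\beta:=\mathbf{id}]$; $(S_3)$ $(\alpha\;(\beta\;u))\rightharpoonup(\beta\;u)$; $(S_4)$ $(\beta\;\mu\alpha\,u)\rightharpoonup u[\alpha:=\lambda y\,(\beta\;y)]$; $(S_5)$ $\mu\alpha\,u\rightharpoonup\lambda z\,\mu\beta\,u[\alpha:=\lambda y\,(\beta\;(y\;z))]$ if $u$ contains a subterm $(\alpha\;\lambda x\,v)$; $(S_6)$ $\mu\alpha\,u[y:=(\alpha\;v)]\rightharpoonup v$ if $y$ is free in $u$ and $\alpha$ not free in $v$. $t\rightharpoonup_{\mu^{++}}t'$: finitely many steps; normal: no step applies. For a set $\mathcal V$ of normal terms, $t\rightarrow_{\mu^{++}}\mathcal V$ means $t\rightharpoonup_{\mu^{++}}u$ for all $u\in\mathcal V$ and every normal $u$ with $t\rightharpoonup_{\mu^{++}}u$ is in $\mathcal V$. Types: second-order formulas with $\perp,\rightarrow,\forall x,\forall X$; $\neg A=A\rightarrow\perp$; $\exists x\,A=\neg\forall x\,\neg A$; $\{A_1,\dots,A_n\rightarrow A\}$ is $A_1\rightarrow(\dots\rightarrow(A_n\rightarrow A))$. $0$ constant, $s$ unary function symbol, $\mathrm{Ent}[x]=\forall X\,\{X(0),\forall y\,(X(y)\rightarrow X(sy))\rightarrow X(x)\}$. Typing $\Gamma\vdash' t:A$ (contexts $x_1:A_1,\dots,x_n:A_n,\alpha_1:\neg B_1,\dots,\alpha_m:\neg B_m$), for a fixed set $E$ of equations with induced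 equivalence $\approx_E$, is generated by: (1) $\Gamma\vdash' x_i:A_i$, $\Gamma\vdash'\alpha_j:\neg B_j$; (2) from $\Gamma,x:A\vdash' u:B$ infer $\Gamma\vdash'\lambda x\,u:A\rightarrow B$; (3) from $\Gamma_1\vdash' u:A\rightarrow B$, $\Gamma_2\vdash' v:A$ infer $\Gamma_1,\Gamma_2\vdash'(u\;v):B$; (4) from $\Gamma\vdash' u:A$, $x$ not free in $\Gamma$, infer $\Gamma\vdash' u:\forall x\,A$; (5) from $\Gamma\vdash' u:\forall x\,A$ infer $\Gamma\vdash' u:A[x:=a]$; (6) from $\Gamma\vdash' u:A$, $X$ not free in $\Gamma$, infer $\Gamma\vdash' u:\forall X\,A$; (7) from $\Gamma\vdash' u:\forall X\,A$ infer $\Gamma\vdash' u:A[X:=G]$; (8) from $\Gamma\vdash' u:A[x:=a]$ and $a\approx_E b$ infer $\Gamma\vdash' u:A[x:=b]$; (9) from $\Gamma,\alpha:\neg B\vdash' u:\perp$ infer $\Gamma\vdash'\mu\alpha\,u:B$. *)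

(* Defs.v *)
From mathcomp Require Import all_boot.
From Stdlib Require Import Relation_Operators.

Set Implicit Arguments.
Unset Strict Implicit.
Unset Printing Implicit Defensive.

(* Syntax with binders is given in de Bruijn style, so that alpha-equivalent
   expressions are equal.  Lambda- and mu-variables live in two independent
   index spaces: [lam] binds index 0 of the first, [mu] index 0 of the second. *)

Inductive tm : Type :=
| var (i : nat)
| mvar (a : nat)
| lam (t : tm)
| mu (t : tm)
| app (t u : tm).

Definition scons {T : Type} (x : T) (s : nat -> T) (i : nat) : T :=
  if i is j.+1 then s j else x.

Definition upr (r : nat -> nat) : nat -> nat := scons 0 (fun i => (r i).+1).

Fixpoint tren (r q : nat -> nat) (t : tm) : tm :=
  match t with
  | var i => var (r i)
  | mvar a => mvar (q a)
  | lam u => lam (tren (upr r) q u)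
  | mu u => mu (tren r (upr q) u)
  | app u v => app (tren r q u) (tren r q v)
  end.

Definition lshift : tm -> tm := tren S id.
Definition mshift : tm -> tm := tren id S.

Fixpoint tsubst (s m : nat -> tm) (t : tm) : tm :=
  match t with
  | var i => s i
  | mvar a => m a
  | lam u => lam (tsubst (scons (var 0) (fun i => lshift (s i)))
                         (fun a => lshift (m a)) u)
  | mu u => mu (tsubst (fun i => mshift (s i))
                       (scons (mvar 0) (fun a => mshift (m a))) u)
  | app u v => app (tsubst s m u) (tsubst s m v)
  end.

(* Substitution for the variable with index 0, whose binder is removed. *)
Definition lsubst0 (u v : tm) : tm := tsubst (scons v var) mvar u.
Definition msubst0 (u v : tm) : tm := tsubst var (scons v mvar) u.

(* The lambda-variable [i] occurs free in [t]. *)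
Fixpoint lfree (i : nat) (t : tm) : bool :=
  match t with
  | var j => j == i
  | mvar _ => false
  | lam u => lfree i.+1 u
  | mu u => lfree i u
  | app u v => lfree i u || lfree i v
  end.

(* [t] has a subterm (alpha lambda x v), where alpha is the free mu-variable
   [a] of [t]. *)
Fixpoint has_mvar_lam (a : nat) (t : tm) : bool :=
  match t with
  | var _ | mvar _ => false
  | lam u => has_mvar_lam a u
  | mu u => has_mvar_lam a.+1 u
  | app u v =>
      [|| match u, v with mvar b, lam _ => b == a | _, _ => false end,
          has_mvar_lam a u | has_mvar_lam a v]
  end.

Definition tid : tm := lam (var 0).
Definition tI : tm := lam (mu (var 0)).
Definition numeral (n : nat) : tm := lam (lam (iter n (app (var 0)) (var 1))).

Inductive rstep : tm -> tm -> Prop :=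
| r_Cl u v : rstep (app (lam u) v) (lsubst0 u v)
(* The new mu-variable beta takes over index 0, so that the other free
   mu-variables of [u] keep their indices; likewise in [r_S5]. *)
| r_Cm u v :
    rstep (app (mu u) v)
          (mu (tsubst var
                 (scons (lam (app (mvar 0) (app (var 0) (lshift (mshift v)))))
                        (fun a => mvar a.+1)) u))
| r_S1 a u v : rstep (app (app (mvar a) u) v) (app (mvar a) u)
| r_S2 u : rstep (mu (mu u)) (mu (msubst0 u tid))
| r_S3 a b u : rstep (app (mvar a) (app (mvar b) u)) (app (mvar b) u)
| r_S4 b u :
    rstep (app (mvar b) (mu u)) (msubst0 u (lam (app (mvar b) (var 0))))
(* In the substituted term [var 0] is y and [var 1] is z. *)
| r_S5 u : has_mvar_lam 0 u ->
    rstep (mu u)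
          (lam (mu (tsubst (fun i => var i.+1)
                      (scons (lam (app (mvar 0) (app (var 0) (var 1))))
                             (fun a => mvar a.+1)) u)))
(* y is the lambda-variable 0 of [u]; "alpha not free in v" is expressed by
   [mshift v]. *)
| r_S6 u v : lfree 0 u ->
    rstep (mu (lsubst0 u (app (mvar 0) (mshift v)))) v.

Inductive red : tm -> tm -> Prop :=
| red_root t t' : rstep t t' -> red t t'
| red_lam t t' : red t t' -> red (lam t) (lam t')
| red_mu t t' : red t t' -> red (mu t) (mu t')
| red_appl t t' u : red t t' -> red (app t u) (app t' u)
| red_appr t u u' : red u u' -> red (app t u) (app t u').

Definition reds : tm -> tm -> Prop := clos_refl_trans tm red.

Definition normal (t : tm) : Prop := forall t', ~ red t t'.

Definition reduces_to_set (t : tm) (V : tm -> Prop) : Prop :=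
  [/\ forall u, V u -> normal u,
      forall u, V u -> reds t u &
      forall u, normal u -> reds t u -> V u].

(* A second-order language: the function symbols other than 0 and s, and the
   predicate symbols, with their arities. *)
Record language : Type := Language {
  fsym : Type;
  farity : fsym -> nat;
  psym : Type;
  parity : psym -> nat
}.

Section Types.

Variable L : language.

Inductive fterm : Type :=
| fvar (i : nat)
| fzero
| fsucc (a : fterm)
| ffn (f : fsym L) (a : {ffun 'I_(farity f) -> fterm}).

Fixpoint fsub (s : nat -> fterm) (t : fterm) : fterm :=
  match t with
  | fvar i => s i
  | fzero => fzero
  | fsucc a => fsucc (fsub s a)
  | ffn f a => ffn [ffun i => fsub s (a i)]
  end.

(* Predicate variables of each arity have their own index space: [fpv n X a]
   is X(a_1, .., a_n), and [fall2 n] binds index 0 among the predicate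
   variables of arity [n]. *)
Inductive form : Type :=
| fbot
| fpv (n X : nat) (a : {ffun 'I_n -> fterm})
| fpc (p : psym L) (a : {ffun 'I_(parity p) -> fterm})
| fimp (A B : form)
| fall1 (A : form)
| fall2 (n : nat) (A : form).

(* Substitution of terms for the individual variables of a formula. *)
Fixpoint fosub (s : nat -> fterm) (A : form) : form :=
  match A with
  | fbot => fbot
  | fpv n X a => fpv X [ffun i => fsub s (a i)]
  | fpc p a => fpc [ffun i => fsub s (a i)]
  | fimp B C => fimp (fosub s B) (fosub s C)
  | fall1 B =>
      fall1 (fosub (scons (fvar 0) (fun i => fsub (fun j => fvar j.+1) (s i))) B)
  | fall2 n B => fall2 n (fosub s B)
  end.

Definition fosub0 (A : form) (a : fterm) : form := fosub (scons a fvar) A.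
Definition foshift : form -> form := fosub (fun i => fvar i.+1).

(* Renaming of predicate variables; [r n] acts on those of arity [n]. *)
Fixpoint soren (r : nat -> nat -> nat) (A : form) : form :=
  match A with
  | fbot => fbot
  | fpv n X a => fpv (r n X) a
  | fpc p a => fpc a
  | fimp B C => fimp (soren r B) (soren r C)
  | fall1 B => fall1 (soren r B)
  | fall2 n B => fall2 n (soren (fun k => if k == n then upr (r k) else r k) B)
  end.

Definition soshift (n : nat) : form -> form :=
  soren (fun k X => if k == n then X.+1 else X).

(* In A[X := G] with X of arity [n], the formula G depends on [n] parameters:
   these are its individual variables 0, .., n-1, and its individual variable
   n + i stands for the ambient variable i. *)
Definition params (n : nat) : {ffun 'I_n -> fterm} := [ffun i => fvar (val i)].

Definition inst_params (n : nat) (a : {ffun 'I_n -> fterm}) (i : nat) : fterm :=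
  if insub i is Some j then a j else fvar (i - n).

Fixpoint sosub (s : nat -> nat -> form) (A : form) : form :=
  match A with
  | fbot => fbot
  | fpv n X a => fosub (inst_params a) (s n X)
  | fpc p a => fpc a
  | fimp B C => fimp (sosub s B) (sosub s C)
  | fall1 B =>
      fall1 (sosub (fun n X =>
        fosub (fun i => fvar (if i < n then i else i.+1)) (s n X)) B)
  | fall2 n B =>
      fall2 n (sosub (fun k =>
        if k == n then scons (fpv 0 (params k)) (fun X => soshift n (s k X))
        else fun X => soshift n (s k X)) B)
  end.

Definition sosub0 (n : nat) (A G : form) : form :=
  sosub (fun k => if k == n then scons G (fun X => fpv X (params k))
                  else fun X => fpv X (params k)) A.

Definition fneg (A : form) : form := fimp A fbot.
Definition fex1 (A : form) : form := fneg (fall1 (fneg A)).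

(* [fall2] binds no individual variable, so [a] needs no shift. *)
Definition Ent (a : fterm) : form :=
  let X t := fpv 0 ([ffun=> t] : {ffun 'I_1 -> fterm}) in
  fall2 1 (fimp (X fzero)
          (fimp (fall1 (fimp (X (fvar 0)) (X (fsucc (fvar 0))))) (X a))).

(* A set of equations is a set of pairs of terms. *)
Variable E : fterm -> fterm -> Prop.

Inductive eqE : fterm -> fterm -> Prop :=
| eqE_ax s a b : E a b -> eqE (fsub s a) (fsub s b)
| eqE_refl a : eqE a a
| eqE_sym a b : eqE a b -> eqE b a
| eqE_trans a b c : eqE a b -> eqE b c -> eqE a c
| eqE_succ a b : eqE a b -> eqE (fsucc a) (fsucc b)
| eqE_fn f (a b : {ffun 'I_(farity f) -> fterm}) :
    (forall i, eqE (a i) (b i)) -> eqE (ffn a) (ffn b).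

(* Entry [i] of a context is [Some A] if the variable [i] is declared, and
   [None] (or beyond the end) otherwise.  A judgement has one context for the
   lambda-variables and one for the mu-variables; in the latter [Some B] stands
   for the declaration alpha : neg B. *)
Definition ctx : Type := seq (option form).

Definition declares (G : ctx) (i : nat) (A : form) : Prop := nth None G i = Some A.

(* [G] is the context "G1, G2", in which declarations common to both parts are
   identified. *)
Definition cunion (G1 G2 G : ctx) : Prop :=
  forall i A, declares G i A <-> declares G1 i A \/ declares G2 i A.

Definition cmap (f : form -> form) : ctx -> ctx := map (omap f).

Inductive typ : ctx -> ctx -> tm -> form -> Prop :=
| ty_var G D i A : declares G i A -> typ G D (var i) A
| ty_mvar G D a B : declares D a B -> typ G D (mvar a) (fneg B)
| ty_lam G D A B u : typ (Some A :: G) D u B -> typ G D (lam u) (fimp A B)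
| ty_app G1 G2 G D1 D2 D A B u v :
    cunion G1 G2 G -> cunion D1 D2 D ->
    typ G1 D1 u (fimp A B) -> typ G2 D2 v A -> typ G D (app u v) B
| ty_all1I G D u A :
    typ (cmap foshift G) (cmap foshift D) u A -> typ G D u (fall1 A)
| ty_all1E G D u A a : typ G D u (fall1 A) -> typ G D u (fosub0 A a)
| ty_all2I G D u n A :
    typ (cmap (soshift n) G) (cmap (soshift n) D) u A -> typ G D u (fall2 n A)
| ty_all2E G D u n A F : typ G D u (fall2 n A) -> typ G D u (sosub0 n A F)
| ty_eq G D u A a b :
    eqE a b -> typ G D u (fosub0 A a) -> typ G D u (fosub0 A b)
| ty_mu G D u B : typ G (Some B :: D) u fbot -> typ G D (mu u) B.

End Types.

Arguments fvar {L} i.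
Arguments fzero {L}.
Arguments fbot {L}.

(* lambda d lambda y (y n) *)
Definition wit (n : nat) : tm := lam (lam (app (var 0) (numeral n))).

(* [Uterm n k] is U_k for the sequence n_1 = n 1, n_2 = n 2, ...; its free
   variables are x ([var 0]) and alpha ([mvar 0]).  [Uterm n 0] is a dummy. *)
Fixpoint Uterm (n : nat -> nat) (k : nat) : tm :=
  match k with
  | 0 => mvar 0
  | k'.+1 =>
      app (mvar 0)
          (app (app (app (var 0) (wit (n k))) tid)
               (if k' is 0 then mvar 0 else app tI (Uterm n k')))
  end.

Definition Pterm (n : nat -> nat) (m : nat) : tm := lam (mu (Uterm n m)).

(* Main.v *)
(* Once x := [numeral 0], an argument t of alpha in mu alpha U_m reduces only to
   terms that still contain alpha and, finally, to an answer lambda y (y n_i);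
   so (S6) extracts nothing but answers.  It extracts each of them, since it
   discards the context in which (alpha t) occurs.  The only other rule that
   fires at that mu is (S5), and it merely eta-expands the answers.  Hence the
   reducts lie in an explicit family, closed under reduction, whose only normal
   members are the answers. *)
Require Import Defs.
From mathcomp Require Import all_boot.
From Stdlib Require Import Relation_Operators.

Set Implicit Arguments.
Unset Strict Implicit.
Unset Printing Implicit Defensive.

(** * Typing of [Pterm] *)

Section Typing.

Variable L : language.
Variable E : fterm L -> fterm L -> Prop.

Let X (t : fterm L) : form L := fpv 0 ([ffun=> t] : {ffun 'I_1 -> fterm L}).

Lemma fosub_Ent s (a : fterm L) : fosub s (Ent a) = Ent (fsub s a).
Proof.
rewrite /Ent /=; congr (fall2 _ (fimp _ (fimp (fall1 (fimp _ _)) _)));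
  by congr fpv; apply/ffunP => i; rewrite !ffunE.
Qed.

Definition ExEnt : form L := fex1 (Ent (fvar 0)).

Lemma fosub_ExEnt s : fosub s ExEnt = ExEnt.
Proof. by congr (fneg (fall1 (fneg _))); apply: fosub_Ent. Qed.

Lemma fosub0_iter_step (a : fterm L) :
  fosub0 (fimp (X (fvar 0)) (X (fsucc (fvar 0)))) a = fimp (X a) (X (fsucc a)).
Proof.
by rewrite /fosub0 /=; congr fimp; congr fpv; apply/ffunP => i; rewrite !ffunE.
Qed.

(** Declarations common to both parts of a split context are identified, so each part may be the
    whole context. *)
Lemma typ_app G D (A B : form L) u v :
  typ E G D u (fimp A B) -> typ E G D v A -> typ E G D (app u v) B.
Proof. by apply: ty_app => i C; split; [left|case|left|case]. Qed.

Lemma typ_numeral G D k : typ E G D (numeral k) (Ent (iter k (@fsucc L) fzero)).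
Proof.
apply: ty_all2I; do 2!apply: ty_lam.
elim: k => [|k IHk] /=; first exact: ty_var.
apply: typ_app IHk; rewrite -/(X _) -/(X (fsucc _)).
rewrite -[in X in typ _ _ _ _ X]fosub0_iter_step.
by apply: ty_all1E; apply: ty_var.
Qed.

(** Here y refutes every Ent[y] and is applied to the numeral [k]; since d is discarded, its type
    [A] is arbitrary. *)
Lemma typ_wit G D (A : form L) k : typ E G D (wit k) (fimp A ExEnt).
Proof.
do 2!apply: ty_lam.
apply: typ_app (typ_numeral _ _ k).
have -> : fimp (Ent (iter k (@fsucc L) fzero)) fbot
        = fosub0 (fneg (Ent (fvar 0))) (iter k (@fsucc L) fzero).
  by congr fneg; symmetry; apply: fosub_Ent.
by apply: ty_all1E; apply: ty_var.
Qed.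

Lemma typ_tI G D (A : form L) : typ E G D tI (fimp fbot A).
Proof. by apply: ty_lam; apply: ty_mu; apply: ty_var. Qed.

Lemma typ_tid G D (A : form L) : typ E G D tid (fimp A A).
Proof. by apply: ty_lam; apply: ty_var. Qed.

(** The predicate variable of [Ent a] is instantiated by a constant predicate: closedness of [F]
    makes the substitution of its parameter, and the shift under [fall1], disappear. *)
Lemma typ_Ent_iter G D (a : fterm L) (F : form L) t u v :
  (forall s, fosub s F = F) ->
  typ E G D t (Ent a) -> typ E G D u F ->
  typ E G D v (fall1 (fimp F F)) -> typ E G D (app (app t u) v) F.
Proof.
move=> Fcl Ht Hu Hv; have := ty_all2E F Ht.
rewrite /sosub0 /= !Fcl => {}Ht.
exact: typ_app (typ_app Ht Hu) Hv.
Qed.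

Lemma typ_Uterm (n : nat -> nat) (a : fterm L) k :
  typ E [:: Some (Ent a)] [:: Some ExEnt] (Uterm n k.+1) fbot.
Proof.
elim: k => [|k IHk] /=.
all: apply: typ_app; first by apply: ty_mvar.
all: apply: (@typ_app _ _ (fneg ExEnt)).
all: try by apply: ty_mvar.
all: try by apply: typ_app (typ_tI _ _ _) IHk.
(* The iteration along x runs at the type [fimp (fneg ExEnt) ExEnt], with [wit] as base and the
   identity as step. *)
all: apply: (@typ_Ent_iter _ _ a); last by apply/ty_all1I/typ_tid.
all: try by [apply: ty_var | apply: typ_wit].
all: by move=> s; congr (fimp (fneg _) _); apply: fosub_ExEnt.
Qed.

Lemma typ_Pterm (n : nat -> nat) k :
  typ E [::] [::] (Pterm n k.+1) (fall1 (fimp (Ent (fvar 0)) ExEnt)).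
Proof. by apply: ty_all1I; apply: ty_lam; apply: ty_mu; apply: typ_Uterm. Qed.

End Typing.

(** * Renaming, closed terms, and normal forms recognised by their shape *)

Lemma upr_inj r : injective r -> injective (upr r).
Proof. by move=> r_inj [|i] [|j] //= [/r_inj->]. Qed.

Lemma tren_inj r q : injective r -> injective q -> injective (tren r q).
Proof.
move=> r_inj q_inj t; elim: t r q r_inj q_inj => [i|a|t IH|t IH|t IHt u IHu] r q
  r_inj q_inj [j|b|t'|t'|t' u'] //=.
- by case=> /r_inj->.
- by case=> /q_inj->.
- by case=> /IH->//; apply: upr_inj.
- by case=> /IH->//; apply: upr_inj.
by case=> /IHt-> // /IHu->.
Qed.

Lemma mshift_inj : injective mshift.
Proof. exact: tren_inj (@inj_id _) succn_inj. Qed.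

Lemma tren_numeral r q k : tren r q (numeral k) = numeral k.
Proof. by rewrite /numeral /=; congr (lam (lam _)); elim: k => //= k ->. Qed.

Lemma tsubst_numeral s m k : tsubst s m (numeral k) = numeral k.
Proof. by rewrite /numeral /=; congr (lam (lam _)); elim: k => //= k ->. Qed.

Lemma tren_wit r q k : tren r q (wit k) = wit k.
Proof. by congr (lam (lam (app _ _))); apply: tren_numeral. Qed.

Lemma tsubst_wit s m k : tsubst s m (wit k) = wit k.
Proof. by congr (lam (lam (app _ _))); apply: tsubst_numeral. Qed.

Arguments numeral : simpl never.
Arguments wit : simpl never.

Definition closedE := (tren_numeral, tsubst_numeral, tren_wit, tsubst_wit).

(** A sufficient criterion for normality: mu does not occur at all, and only lambda-variables are
    applied. *)
Fixpoint lnf (t : tm) : bool :=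
  match t with
  | var _ => true
  | lam u => lnf u
  | app (var _) v => lnf v
  | _ => false
  end.

Lemma lnf_normal t : lnf t -> normal t.
Proof.
move=> Ht t' Htt'; elim: Htt' Ht => {t t'} [t t' [] // |||t t' u|[] //] //=.
by case: t => // i Hred; inversion Hred; match goal with H : rstep _ _ |- _ => inversion H end.
Qed.

Lemma lnf_numeral k : lnf (numeral k).
Proof. by rewrite /numeral /=; elim: k. Qed.

Lemma lnf_wit k : lnf (wit k).
Proof. exact: lnf_numeral. Qed.

Definition answer (k : nat) : tm := lam (app (var 0) (numeral k)).

Lemma lnf_answer k : lnf (answer k).
Proof. exact: lnf_numeral. Qed.

Lemma tren_answer r q k : tren r q (answer k) = answer k.
Proof. by congr (lam (app _ _)); apply: tren_numeral. Qed.

Lemma tsubst_answer s m k : tsubst s m (answer k) = answer k.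
Proof. by congr (lam (app _ _)); apply: tsubst_numeral. Qed.

(** * Free mu-variables and uncaptured occurrences *)

Fixpoint mfree (a : nat) (t : tm) : bool :=
  match t with
  | var _ => false
  | mvar b => b == a
  | lam u => mfree a u
  | mu u => mfree a.+1 u
  | app u v => mfree a u || mfree a v
  end.

Lemma mfree_tren r q a t : injective q -> mfree (q a) (tren r q t) = mfree a t.
Proof.
elim: t r q a => [i|b|t IH|t IH|t IHt u IHu] r q a q_inj //=.
- exact: inj_eq.
- exact: IH.
- by rewrite -(IH (r) (upr q)) //; apply: upr_inj.
by rewrite IHt ?IHu.
Qed.

Lemma mfree_lshift a t : mfree a (Defs.lshift t) = mfree a t.
Proof. exact: (@mfree_tren _ id). Qed.

Lemma mfreeS_mshift a t : mfree a.+1 (mshift t) = mfree a t.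
Proof. exact: mfree_tren succn_inj. Qed.

Lemma mfree_tren_notin r q a t : (forall b, q b != a) -> mfree a (tren r q t) = false.
Proof.
elim: t r q a => [i|b|t IH|t IH|t IHt u IHu] r q a Nq //=.
- exact/negbTE.
- exact: IH.
- by apply: IH => -[|b]; rewrite //= eqSS.
by rewrite IHt ?IHu.
Qed.

Lemma mfree0_mshift t : mfree 0 (mshift t) = false.
Proof. exact: mfree_tren_notin. Qed.

Lemma lnf_mfree a t : lnf t -> mfree a t = false.
Proof. elim: t => //= [u IHu v IHv]. by case: u IHu => //=. Qed.

Lemma has_mvar_lam_mfree a t : has_mvar_lam a t -> mfree a t.
Proof.
elim: t a => //= [t IH a /IH //|t IHt u IHu a /or3P[|/IHt->|/IHu->]]; rewrite ?orbT //.
by case: t {IHt} => // b; case: u {IHu} => //= v ->.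
Qed.

(* [occ w t]: [w] is a subterm of [t] none of whose free variables is captured. *)
Inductive occ : tm -> tm -> Prop :=
| occ_refl t : occ t t
| occ_lam w t : occ (Defs.lshift w) t -> occ w (lam t)
| occ_mu w t : occ (mshift w) t -> occ w (mu t)
| occ_appl w t u : occ w t -> occ w (app t u)
| occ_appr w t u : occ w u -> occ w (app t u).

Lemma occ_mfree a w t : occ w t -> mfree a w -> mfree a t.
Proof.
move=> Ho; elim: Ho a => {w t} [//|w t _ IH|w t _ IH|w t u _ IH|w t u _ IH] a Hw /=.
- by apply: IH; rewrite mfree_lshift.
- by apply: IH; rewrite mfreeS_mshift.
- by rewrite (IH a Hw).
by rewrite (IH a Hw) orbT.
Qed.

(** This reduces (S6) to a question about subterms: as y is free in u, the body u[y := (alpha v)] of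
    the redex contains (alpha v) uncaptured. *)
Lemma occ_tsubst i u s m : lfree i u -> occ (s i) (tsubst s m u).
Proof.
elim: u i s m => //= [j|u IH|u IH|u IHu v IHv] i s m.
- by move/eqP->; apply: occ_refl.
- by move=> /IH Hu; apply: occ_lam; apply: (Hu (scons _ _)).
- by move=> /IH Hu; apply: occ_mu; apply: (Hu (fun i => mshift (s i))).
by case/orP=> [/IHu|/IHv] H; [apply: occ_appl|apply: occ_appr].
Qed.

Lemma witE k : wit k = lam (answer k).
Proof. by []. Qed.

Lemma answerE k : answer k = lam (app (var 0) (numeral k)).
Proof. by []. Qed.

Lemma numeral0E : numeral 0 = lam (lam (var 1)).
Proof. by []. Qed.

Lemma rstep_beta u v w : rstep (app (lam u) v) w -> w = lsubst0 u v.
Proof. by move=> H; inversion H. Qed.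

(* The family of reducts and its free mu-variables *)
Opaque numeral wit answer.

(* [Before]: the argument is still the variable x; [After]: it is [numeral 0];
   [Eta]: moreover (S5) has replaced alpha by [lam y (beta (y z))], where z is
   the lambda-variable 0. *)
Inductive phase := Before | After | Eta.

Definition input (p : phase) : tm := if p is Before then var 0 else numeral 0.

Definition cont (p : phase) (a : nat) : tm :=
  if p is Eta then lam (app (mvar a) (app (var 0) (var 1))) else mvar a.

Inductive part := Named | Candidate | Dropped.

(* [Named]: the reducts of the [Uterm n k] (alpha has index [a]); [Candidate]:
   those of the arguments of alpha in them; [Dropped]: those of the argument
   of [wit (n k)]. *)
Inductive reduct (Q : nat -> Prop) (p : phase) : part -> nat -> tm -> Prop :=
| named_cont a t : reduct Q p Candidate a t -> reduct Q p Named a (app (cont p a) t)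
| named_eta a t : p = Eta -> reduct Q p Candidate a t ->
    reduct Q p Named a (app (mvar a) (app t (var 0)))
| named_answer a k : p = Eta -> Q k ->
    reduct Q p Named a (app (mvar a) (app (var 0) (numeral k)))
| cand_input a k d : Q k -> reduct Q p Dropped a d ->
    reduct Q p Candidate a (app (app (app (input p) (wit k)) tid) d)
| cand_lam a k d : Q k -> p <> Before -> reduct Q p Dropped a d ->
    reduct Q p Candidate a (app (app (lam (wit k)) tid) d)
| cand_wit a k d : Q k -> p <> Before -> reduct Q p Dropped a d ->
    reduct Q p Candidate a (app (wit k) d)
| cand_answer a k : Q k -> p <> Before -> reduct Q p Candidate a (answer k)
| drop_cont a : reduct Q p Dropped a (cont p a)
| drop_app a t : reduct Q p Named a t -> reduct Q p Dropped a (app tI t)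
| drop_mu a t : reduct Q p Named a.+1 t -> reduct Q p Dropped a (mu t).

Section Reducts.

Variable Q : nat -> Prop.

Let mfree_closed := (fun a k => lnf_mfree a (lnf_numeral k),
  fun a k => lnf_mfree a (lnf_wit k), fun a k => lnf_mfree a (lnf_answer k)).

Lemma mfree_cont p c a : mfree c (cont p a) = (a == c).
Proof. by case: p => //=; rewrite orbF. Qed.

Lemma mfree_input p c : mfree c (input p) = false.
Proof. by case: p. Qed.

Lemma reduct_mfree p k a t c : reduct Q p k a t -> mfree c t -> c = a.
Proof.
move=> Ht; elim: Ht c => {k a t} /= [a t _ IH|a t _ _ IH|a k _ _|a k d _ _ IH|
  a k d _ _ _ IH|a k d _ _ _ IH|a k _ _|a|a t _ IH|a t _ IH] c;
  rewrite ?mfree_cont ?mfree_input ?mfree_closed ?orbF //=.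
all: try by [case/orP=> [/eqP|/IH] | move/eqP | move/IH | move/IH=> []].
Qed.

(** Alpha disappears from a candidate only when [wit] discards its argument, which leaves an answer;
    a named term still has alpha at its head. *)
Lemma reduct_mfree_self p k a t : reduct Q p k a t ->
  mfree a t \/ [/\ k = Candidate, p <> Before & exists2 j, Q j & t = answer j].
Proof.
move=> Ht; elim: Ht => {k a t} /=.
all: intros; rewrite ?mfree_cont ?eqxx ?orbT; try by left.
all: try match goal with H : _ \/ [/\ Dropped = _, _ & _] |- _ => by case: H => [->|[]]; rewrite ?orbT //; left end.
all: try match goal with H : _ \/ [/\ Named = _, _ & _] |- _ => by case: H => [->|[]]; rewrite ?orbT //; left end.
by right; split => //; exists k.
Qed.

(** This confines (S5) to the phase [After]: in [Before] no candidate is an abstraction, and in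
    [Eta] the mu-variable is only ever applied to applications. *)
Lemma reduct_has_mvar_lam p k a t c :
  reduct Q p k a t -> has_mvar_lam c t -> p = After.
Proof.
move=> Ht Hc; have E : c = a by apply: reduct_mfree Ht (has_mvar_lam_mfree Hc).
move: E Hc => -> {c}.
have N b u : lnf u -> has_mvar_lam b u = false.
  by move=> Hu; apply/negP=> /has_mvar_lam_mfree; rewrite lnf_mfree.
elim: Ht => {k a t} /=.
- move=> a t Ht IH /or3P[Hc| |/IH//]; last by case: (p).
  by case: (p) Ht Hc => //= Ht; inversion Ht.
- by move=> a t _ _ IH /or3P[|/IH|] //; case: t {IH}.
- by move=> a k _ _; rewrite N ?lnf_numeral.
- move=> a k d _ _ IH /orP[/orP[/or3P[|Hc|]|//]|/IH//].
  + by case: (p).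
  + by case: (p) Hc; rewrite /= ?N ?lnf_numeral.
  + by rewrite N ?lnf_wit.
- by move=> a k d _ _ _ IH /orP[/orP[|//]|/IH//]; rewrite N ?lnf_wit.
- by move=> a k d _ _ _ IH; rewrite witE /= N ?lnf_answer.
- by move=> a k _ _; rewrite N ?lnf_answer.
- by case: (p).
- by move=> a t _ IH.
- by [].
Qed.

(** In [Eta] the extraction takes place below the binder of z ([var 0]), where the answer is applied
    to z or that application is already contracted. *)
Definition extracted (p : phase) (t : tm) : Prop :=
  exists2 k, Q k & match p with
    | Before => False
    | After => t = answer k
    | Eta => t = app (answer k) (var 0) \/ t = app (var 0) (numeral k)
    end.

(** Extracted terms have no mu-variables, so they are fixed by the injective [mshift]. *)
Lemma extracted_mshift p t : extracted p (mshift t) -> extracted p t.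
Proof.
case=> k Qk H; exists k => //; case: p H => //=.
  by rewrite -{1}(tren_answer id S) => /mshift_inj.
have E : mshift (app (answer k) (var 0)) = app (answer k) (var 0).
  by congr app; apply: tren_answer.
have E' : mshift (app (var 0) (numeral k)) = app (var 0) (numeral k).
  by congr app; apply: tren_numeral.
by case; [rewrite -{1}E|rewrite -{1}E'] => /mshift_inj; auto.
Qed.

Lemma lnf_occ a t u : lnf t -> ~ occ (app (mvar a) u) t.
Proof.
by move=> Ht /(occ_mfree (a := a)) /=; rewrite eqxx (lnf_mfree _ Ht) => /(_ isT).
Qed.

Lemma occ_var i c w : ~ occ (app (mvar c) w) (var i).
Proof. by move=> H; inversion H. Qed.

Lemma occ_mvar a c w : ~ occ (app (mvar c) w) (mvar a).
Proof. by move=> H; inversion H. Qed.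

Lemma occ_app w t u : occ w (app t u) -> [\/ w = app t u, occ w t | occ w u].
Proof. by move=> H; inversion H; subst; [apply: Or31|apply: Or32|apply: Or33]. Qed.

Lemma occ_cont p a c w : ~ occ (app (mvar c) w) (cont p a).
Proof.
case: p => [/occ_mvar|/occ_mvar|H] //; inversion H as [|? ? H'| | |]; subst.
have {}H' : occ (app (mvar c) (Defs.lshift w)) (app (mvar a) (app (var 0) (var 1))) by [].
case/occ_app: H' => [[_]|/occ_mvar//|]; first by case: w {H} => // [] [].
by case/occ_app=> [|/occ_var|/occ_var].
Qed.

Lemma occ_input p c w : ~ occ (app (mvar c) w) (input p).
Proof. by case: p => /= H; [inversion H|apply: lnf_occ H|apply: lnf_occ H]. Qed.

Lemma occ_app_app c w t u v : occ (app (mvar c) w) (app (app t u) v) ->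
  occ (app (mvar c) w) (app t u) \/ occ (app (mvar c) w) v.
Proof. by case/occ_app; auto. Qed.

(** The analysis behind (S6): an argument of alpha either still mentions alpha, which blocks the
    rule, or has come down to an answer, up to the application to z in [Eta]. *)
Lemma reduct_occ p k a t w : reduct Q p k a t -> occ (app (mvar a) w) t ->
  mfree a w \/ extracted p w.
Proof.
move=> Ht; elim: Ht w => {k a t}.
- move=> a t Ht IH w /occ_app[Ew|/occ_cont//|/IH//].
  have Np : p <> Eta by move=> Ep; rewrite Ep in Ew.
  have -> : w = t by case: Ew.
  case: (reduct_mfree_self Ht); first by left.
  by case=> _ Np' [j Qj ->]; right; exists j => //; case: (p) Np Np'.
- move=> a t Ep Ht IH w /occ_app[[->]|/occ_mvar//|].
    case: (reduct_mfree_self Ht) => /= [->|]; first by left.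
    by case=> _ _ [j Qj ->]; right; exists j; rewrite ?Ep //; left.
  case/occ_app => [[Et _]|/IH//|/occ_var//].
  by rewrite -Et in Ht; inversion Ht.
- move=> a k Ep Qk w /occ_app[[->]|/occ_mvar//|/lnf_occ []].
    by right; exists k; rewrite ?Ep //; right.
  exact: lnf_numeral.
- move=> a k d Qk Hd IH w.
  case/occ_app_app => [|/IH//].
  case/occ_app_app => [|/lnf_occ[]//].
  case/occ_app => [|/occ_input//|/lnf_occ[]]; last exact: lnf_wit.
  by case: (p).
- move=> a k d Qk _ Hd IH w.
  case/occ_app_app => [|/IH//].
  by case/occ_app => [|/lnf_occ[]|/lnf_occ[]] //; exact: lnf_wit.
- move=> a k d Qk _ Hd IH w.
  by case/occ_app => [|/lnf_occ[]|/IH//]; last exact: lnf_wit.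
- by move=> a k Qk _ w /lnf_occ[]; apply: lnf_answer.
- by move=> a w /occ_cont.
- move=> a t _ IH w /occ_app[//| |/IH//].
  by move=> /(occ_mfree (a := a)) /=; rewrite eqxx => /(_ isT).
move=> a t _ IH w H; inversion H; subst.
have [||[k Qk Hw]] := IH (mshift w) => //.
  by rewrite mfreeS_mshift; left.
by right; apply: extracted_mshift; exists k.
Qed.

Lemma reduct_tren p k a t q : reduct Q p k a t -> reduct Q p k (q a) (tren id q t).
Proof.
have Ei r : tren id r (input p) = input p by case: (p); rewrite //= tren_numeral.
have Ec r b : tren id r (cont p b) = cont p (r b) by case: (p).
move=> Ht; elim: Ht q => {k a t}.
all: intros; rewrite /= ?Ei ?Ec ?closedE ?tren_answer.
all: first [apply: named_cont | apply: named_eta | apply: named_answer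
  | apply: cand_input | apply: cand_lam | apply: cand_wit | apply: cand_answer
  | apply: drop_cont | apply: drop_app | apply/drop_mu/(H0 (upr q))] => //.
Qed.

(** One statement serves both changes of phase: the beta step that instantiates x, from [Before] to
    [After], and (S5), from [After] to [Eta]. *)
Lemma reduct_tsubst p q k a t s m : p <> Eta -> q <> Before ->
  (p = Before -> s 0 = numeral 0) -> m a = cont q a ->
  reduct Q p k a t -> reduct Q q k a (tsubst s m t).
Proof.
move=> Np Nq Es Em Ht.
have Ec b : cont p b = mvar b by case: (p) Np.
have Ei s' m' : (p = Before -> s' 0 = numeral 0) -> tsubst s' m' (input p) = input q.
  by case: (q) (p) Nq Np => [] [] //= _ _; rewrite ?tsubst_numeral; auto.
elim: Ht s m Es Em => {k a t}.
all: intros; rewrite ?Ec /= ?Ei ?closedE ?tsubst_answer //; try rewrite Em.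
all: first [apply: named_cont | apply: named_eta | apply: named_answer
  | apply: cand_input | apply: cand_lam | apply: cand_wit | apply: cand_answer
  | apply: drop_cont | apply: drop_app | apply: drop_mu] => //; auto.
apply: H0; first by move/Es=> /= ->; apply: tren_numeral.
by rewrite /= Em; case: (q).
Qed.

(** * Inversion of reduction and closure of the family *)

Lemma red_app t u v : red (app t u) v -> [\/ rstep (app t u) v,
  exists2 t', red t t' & v = app t' u | exists2 u', red u u' & v = app t u'].
Proof.
move=> H; inversion H; subst; first exact: Or31.
  by apply: Or32; exists t'.
by apply: Or33; exists u'.
Qed.

Lemma red_lamE t v : red (lam t) v -> exists2 t', red t t' & v = lam t'.
Proof.
move=> H; inversion H as [? ? H'|? t' H'| | |]; subst; last by exists t'.
by inversion H'.
Qed.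

Lemma rstep_mu t v : rstep (mu t) v -> [\/ exists u, t = mu u,
  has_mvar_lam 0 t /\ v = lam (mu (tsubst (fun i => var i.+1)
     (scons (cont Eta 0) (fun a => mvar a.+1)) t))
  | occ (app (mvar 0) (mshift v)) t].
Proof.
move=> H; inversion H; subst; [apply: Or31|exact: Or32|apply: Or33].
  by exists u.
exact: (@occ_tsubst 0 _ (scons _ var)).
Qed.

(** Both (S5) and (S6) need an occurrence of the bound variable, and the shape of the body excludes
    (S2). *)
Lemma red_mu_vacuous t v : (forall u, t <> mu u) -> mfree 0 t = false ->
  red (mu t) v -> exists2 t', red t t' & v = mu t'.
Proof.
move=> Nmu Nf H; inversion H as [? ? H'| |? t' H'| |]; subst; last by exists t'.
case: (rstep_mu H') => [[u /Nmu]//|[/has_mvar_lam_mfree]|/(occ_mfree (a := 0))].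
  by rewrite Nf.
by rewrite Nf /= => /(_ isT).
Qed.

Lemma input_normal p : normal (input p).
Proof. by case: p; apply: lnf_normal; rewrite ?lnf_numeral. Qed.

Lemma var_normal i : normal (var i).
Proof. exact: lnf_normal. Qed.

Lemma tI_normal : normal tI.
Proof. by move=> t /red_lamE[t' /red_mu_vacuous[]// u /var_normal]. Qed.

Lemma mvar_normal a : normal (mvar a).
Proof. by move=> t H; inversion H as [? ? H'| | | |]; inversion H'. Qed.

Lemma red_mvar_app a t v : (forall b u, t <> app (mvar b) u) -> (forall u, t <> mu u) ->
  red (app (mvar a) t) v -> exists2 t', red t t' & v = app (mvar a) t'.
Proof.
move=> Napp Nmu /red_app[H|[? /mvar_normal]|] //.
by inversion H; subst; [case: (Napp b u)|case: (Nmu u)].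
Qed.

Lemma cont_normal p a : normal (cont p a).
Proof.
case: p => /=; try exact: mvar_normal.
by move=> t /red_lamE[t' /red_mvar_app[]// u /(@lnf_normal (app (var 0) (var 1)) isT)].
Qed.

(** These shapes exclude (S3) and (S4) when alpha is applied to a candidate; when a candidate is
    applied to z, they leave only the beta step of an answer at the root. *)
Lemma candidate_shape p a t : reduct Q p Candidate a t ->
  [/\ forall b u, t <> app (mvar b) u, forall u, t <> mu u, forall b, t <> mvar b &
      forall u, t = lam u -> exists2 k, Q k & u = app (var 0) (numeral k)].
Proof.
move=> H; inversion H; subst; split => //.
by move=> u [<-]; exists k.
Qed.

Lemma named_shape p a t : reduct Q p Named a t -> forall u, t <> mu u.
Proof. by move=> H; inversion H. Qed.

Lemma reduct_red p k a t t' : reduct Q p k a t -> red t t' -> reduct Q p k a t'.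
Proof.
have Nn j : normal (numeral j) := lnf_normal (lnf_numeral j).
have Nw j : normal (wit j) := lnf_normal (lnf_wit j).
move=> Ht; elim: Ht t' => {k a t}.
- move=> a t Ht IH t'; have [Napp Nmu _ _] := candidate_shape Ht.
  case/red_app => [|[? /cont_normal//]|[u /IH Hu ->]]; last exact: named_cont.
  (* Only [Eta] has a root redex here: (lambda y (beta (y z))) applied to [t] contracts to (beta (t
     z)). *)
  case Ep: p => /= Hr; inversion Hr; subst; try by [case: (Napp b u)|case: (Nmu u)].
  exact: named_eta.
- move=> a t Ep Ht IH t'; have [Napp Nmu Nmvar Nlam] := candidate_shape Ht.
  move=> Hr; have [b u [] /Nmvar//|//|v {}Hr ->] := red_mvar_app _ _ Hr.
  case/red_app: Hr => [Hr|[u /IH Hu ->]|[? /var_normal//]]; last exact: named_eta.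
  inversion Hr; subst; try by [case: (Nmvar a0)|case: (Napp a0 u)|case: (Nmu u)].
  have [k Qk ->] := Nlam _ erefl.
  have -> : lsubst0 (app (var 0) (numeral k)) (var 0) = app (var 0) (numeral k).
    by congr app; apply: tsubst_numeral.
  exact: named_answer.
- by move=> a k Ep Qk t' /red_mvar_app[]// u /lnf_normal[]; apply: lnf_numeral.
- move=> a k d Qk Hd IH t' /red_app[Hr|[u Hu ->]|[u /IH Hu ->]]; last exact: cand_input.
    by inversion Hr.
  case/red_app: Hu => [Hr|[v Hv ->]|[? /(@lnf_normal tid isT)//]].
    by case: (p) Hr => /= Hr; rewrite ?numeral0E in Hr; inversion Hr.
  case/red_app: Hv => [Hr|[? /input_normal//]|[? /Nw//]].
  have Np : p <> Before by move=> Ep; rewrite Ep /= in Hr; inversion Hr.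
  have -> : v = lam (wit k).
    have {}Hr : rstep (app (lam (lam (var 1))) (wit k)) v.
      by rewrite -numeral0E; case: (p) Np Hr.
    by rewrite (rstep_beta Hr); congr lam; apply: tren_wit.
  exact: cand_lam.
- move=> a k d Qk Np Hd IH t' /red_app[Hr|[u Hu ->]|[u /IH Hu ->]]; last exact: cand_lam.
    by inversion Hr.
  case/red_app: Hu => [Hr|[? /red_lamE[? /Nw//]]|[? /(@lnf_normal tid isT)//]].
  by rewrite (rstep_beta Hr) /lsubst0 tsubst_wit; apply: cand_wit.
- move=> a k d Qk Np Hd IH t' /red_app[Hr|[? /Nw//]|[u /IH Hu ->]]; last exact: cand_wit.
  have -> : t' = answer k.
    by rewrite witE in Hr; rewrite (rstep_beta Hr); apply: tsubst_answer.
  exact: cand_answer.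
- by move=> a k Qk Np t' /lnf_normal[]; apply: lnf_answer.
- by move=> a t' /cont_normal.
- move=> a t Ht IH t' /red_app[Hr|[? /tI_normal//]|[u /IH Hu ->]]; last exact: drop_app.
  (* Contracting [tI] puts [t] under a new mu, so alpha moves to index [a.+1]. *)
  inversion Hr; subst; apply: drop_mu.
  exact: (reduct_tren succn).
(* The binder is vacuous: [a.+1] is the only free mu-variable of the body. *)
move=> a t Ht IH t' /red_mu_vacuous[].
- exact: named_shape Ht.
- by apply/negP=> /(reduct_mfree Ht).
by move=> u /IH Hu ->; apply: drop_mu.
Qed.

Lemma candidate_normal p a t : p <> Before -> reduct Q p Candidate a t -> normal t ->
  exists2 k, Q k & t = answer k.
Proof.
move=> Np H; inversion H as [| | |? k d Qk Hd|? k d Qk _ Hd|? k d Qk _ Hd|? k Qk _| | |];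
  subst; last by exists k.
- have -> : input p = numeral 0 by case: (p) Np.
  rewrite numeral0E => /(_ _ (red_appl _ (red_appl _ (red_root (r_Cl _ _)))))[].
- by move=> /(_ _ (red_appl _ (red_root (r_Cl _ _))))[].
by rewrite witE => /(_ _ (red_root (r_Cl _ _)))[].
Qed.

Lemma rstep_S6_root v : rstep (mu (app (mvar 0) (mshift v))) v.
Proof. exact: (@r_S6 (var 0)). Qed.

(** * The stages of the whole computation *)

(** [stage_beta] arises when (S6) fires below z before the answer applied to z has been
    contracted. *)
Inductive stage : tm -> Prop :=
| stage_start t : reduct Q Before Named 0 t -> stage (app (lam (mu t)) (numeral 0))
| stage_mu t : reduct Q After Named 0 t -> stage (mu t)
| stage_eta t : reduct Q Eta Named 0 t -> stage (lam (mu t))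
| stage_beta k : Q k -> stage (lam (app (answer k) (var 0)))
| stage_answer k : Q k -> stage (answer k).

Lemma red_stage_mu p t v : reduct Q p Named 0 t -> red (mu t) v ->
  [\/ exists2 t', reduct Q p Named 0 t' & v = mu t',
      p = After /\ v = lam (mu (tsubst (fun i => var i.+1)
         (scons (cont Eta 0) (fun a => mvar a.+1)) t))
    | extracted p v].
Proof.
move=> Ht H; inversion H as [? ? Hr| |? t' Hr| |]; subst; last first.
  by apply: Or31; exists t' => //; apply: reduct_red Ht Hr.
case: (rstep_mu Hr) => [[u /(named_shape Ht)]//|[/(reduct_has_mvar_lam Ht)]|].
  by move=> ? ?; apply: Or32.
case/(reduct_occ Ht) => [|[k Qk Ev]].
  by rewrite mfree0_mshift.
by apply/Or33/extracted_mshift; exists k.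
Qed.

Lemma stage_red t t' : stage t -> red t t' -> stage t'.
Proof.
case=> {t} [t Ht|t Ht|t Ht|k Qk|k Qk].
- case/red_app=> [/rstep_beta ->|[? /red_lamE[? /(red_stage_mu Ht)]]|].
  + apply: stage_mu; apply: reduct_tsubst Ht => // _; exact: tren_numeral.
  + case=> [[u Hu ->] -> ->|[]//|[? _ []]]; exact: stage_start.
  + by case=> u /lnf_normal[]; apply: lnf_numeral.
- case/(red_stage_mu Ht) => [[u Hu ->]|[_ ->]|[k Qk ->]].
  + exact: stage_mu.
  + by apply: stage_eta; apply: reduct_tsubst Ht.
  + exact: stage_answer.
- case/red_lamE=> ? /(red_stage_mu Ht) [[u Hu ->] ->|[]//|[k Qk [] ->] ->].
  + exact: stage_eta.
  + exact: stage_beta.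
  + exact: stage_answer.
- case/red_lamE=> ? /red_app[/rstep_beta -> ->|[? /lnf_normal[]]|[? /var_normal]//].
  + have -> : lsubst0 (app (var 0) (numeral k)) (var 0) = app (var 0) (numeral k).
      by congr app; apply: tsubst_numeral.
    exact: stage_answer.
  + exact: lnf_answer.
- by move/lnf_normal=> []; apply: lnf_answer.
Qed.

Lemma stage_reds t t' : reds t t' -> stage t -> stage t'.
Proof. by elim=> {t t'} [t t' H /stage_red|//|t u v _ IH1 _ IH2 /IH1]; auto. Qed.

(** Once its candidate is normal, hence an answer, a stage below mu still has a redex: (S6) in
    [After]; in [Eta] a beta redex, or (S6) when the answer has already consumed z. *)
Lemma stage_normal t : stage t -> normal t -> exists2 k, Q k & t = answer k.
Proof.
case=> {t} [t Ht|t Ht|t Ht|k Qk|k Qk].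
- by move=> /(_ _ (red_root (r_Cl _ _))).
- inversion Ht as [? u Hu| | | | | | | | |] => //; subst => Hn.
  have [||k Qk Ek] := candidate_normal _ Hu => //.
    by move=> v Hv; apply: (Hn (mu _)); apply/red_mu/red_appr/Hv.
  case: (Hn (answer k)); apply: red_root.
  by have := rstep_S6_root (answer k); rewrite /mshift tren_answer Ek.
- inversion Ht as [? u Hu|? u _ Hu|? k _ Qk| | | | | | |] => //; subst => Hn.
  + by case: (Hn _ (red_lam (red_mu (red_root (r_Cl _ _))))).
  + have [||k Qk Ek] := candidate_normal _ Hu => //.
      by move=> v Hv; apply: (Hn (lam (mu _))); apply/red_lam/red_mu/red_appr/red_appl/Hv.
    rewrite Ek answerE in Hn.
    by case: (Hn _ (red_lam (red_mu (red_appr _ (red_root (r_Cl _ _)))))).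
  + case: (Hn (lam (app (var 0) (numeral k)))).
    apply/red_lam/red_root.
    by have := rstep_S6_root (app (var 0) (numeral k)); rewrite /mshift /= tren_numeral.
- by rewrite answerE => /(_ _ (red_lam (red_root (r_Cl _ _)))).
- by exists k.
Qed.

End Reducts.

(** * The initial term, and reachability of every answer *)

Lemma reduct_Uterm (Q : nat -> Prop) n k :
  (forall j, 1 <= j <= k.+1 -> Q (n j)) -> reduct Q Before Named 0 (Uterm n k.+1).
Proof.
elim: k => [|k IHk] Qn /=; apply: (@named_cont _ Before); apply: (@cand_input _ Before).
all: try by apply: Qn; rewrite /= leqnn.
  exact: (@drop_cont _ Before).
apply/drop_app/IHk => j /andP[j1 jk]; apply: Qn; by rewrite j1 leqW.
Qed.

Lemma reds_congr (f : tm -> tm) t u :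
  (forall t u, red t u -> red (f t) (f u)) -> reds t u -> reds (f t) (f u).
Proof.
move=> Hf; elim=> {t u} [t u /Hf H|t|t u v _ IH1 _ IH2].
- exact: rt_step.
- exact: rt_refl.
exact: rt_trans IH1 IH2.
Qed.

(** [numeral 0] returns [wit k] and discards the identity; [wit k] then discards [d]. *)
Lemma reds_candidate k d : reds (app (app (app (numeral 0) (wit k)) tid) d) (answer k).
Proof.
apply: (@rt_trans _ _ _ (app (app (lam (wit k)) tid) d)).
  apply/rt_step/red_appl/red_appl/red_root; rewrite numeral0E.
  by have := r_Cl (lam (var 1)) (wit k); rewrite /lsubst0 /= /Defs.lshift tren_wit.
apply: (@rt_trans _ _ _ (app (wit k) d)).
  apply/rt_step/red_appl/red_root.
  by have := r_Cl (wit k) tid; rewrite /lsubst0 tsubst_wit.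
apply/rt_step/red_root.
by have := r_Cl (answer k) d; rewrite /lsubst0 tsubst_answer.
Qed.

(** [u] is the context around (alpha answer), with variable 0 as its hole: the form that (S6) asks
    for. Fixing [s] and [m] at 0 only is enough, as x and alpha are the free variables of [Uterm],
    and it lets the substitution be one pushed under mu. *)
Lemma reds_Uterm n i k s m : s 0 = numeral 0 -> m 0 = mvar 0 -> 1 <= i <= k ->
  exists2 u, lfree 0 u &
    reds (tsubst s m (Uterm n k)) (lsubst0 u (app (mvar 0) (answer (n i)))).
Proof.
move=> s0 m0; elim: k => [|k IHk]; first by case: i.
case/andP=> i1; rewrite leq_eqVlt => /orP[/eqP Ei|ik].
  (* The outermost level: the whole term becomes (alpha answer), so the context is a bare hole. *)
  exists (var 0) => //=; rewrite s0 m0 tsubst_wit -Ei.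
  by apply: reds_congr (reds_candidate _ _) => *; apply: red_appr.
have [|u u0 Hu] := IHk; first by rewrite i1.
exists (app (mvar 0) (app (app (app (numeral 0) (wit (n k.+1))) tid) (app tI u))).
  by rewrite /= u0 !orbT.
(* At [k = 0] there is no inner level, and [1 <= i < 1] is absurd. *)
case: k ik Hu {IHk} => [|k] ik Hu; first by move: i1; rewrite leqNgt ik.
pose C t := app (mvar 0) (app (app (app (numeral 0) (wit (n k.+2))) tid) (app tI t)).
have -> : tsubst s m (Uterm n k.+2) = C (tsubst s m (Uterm n k.+1)).
  by rewrite -[LHS]/(app (m 0) (app (app (app (s 0) (tsubst s m (wit _))) tid)
    (app tI (tsubst s m (Uterm n k.+1))))) s0 m0 tsubst_wit.
rewrite /lsubst0 [tsubst (scons _ _) _ _]/= !closedE.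
apply: (@reds_congr C) Hu => t v Htv.
by do 3!apply: red_appr.
Qed.

Theorem theorem10 (L : language) (E : fterm L -> fterm L -> Prop)
    (m : nat) (n : nat -> nat) (hm : 1 <= m) :
  typ E [::] [::] (Pterm n m)
      (fall1 (fimp (Ent (@fvar L 0)) (fex1 (Ent (@fvar L 0))))) /\
  reduces_to_set (app (Pterm n m) (numeral 0))
      (fun t => exists i : nat,
         1 <= i <= m /\ t = lam (app (var 0) (numeral (n i)))).
Proof.
case: m hm => // m _; split.
  exact: typ_Pterm.
(* The family records the values [n i] rather than the indices, which a term does not determine. *)
pose Q j := exists2 i, 1 <= i <= m.+1 & j = n i.
split.
- move=> _ [i [_ ->]]; apply: lnf_normal; exact: lnf_answer.
- move=> _ [i [im ->]]; rewrite -/(answer (n i)).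
  apply: rt_trans (rt_step _ _ _ _ (red_root (r_Cl _ _))) _; rewrite /lsubst0 [tsubst _ _ _]/=.
  have [u u0 Hu] := @reds_Uterm n i m.+1 (fun j => mshift (scons (numeral 0) var j))
    (scons (mvar 0) (fun a => mshift (mvar a))) (tren_numeral _ _ _) erefl im.
  apply: rt_trans (@reds_congr mu _ _ red_mu Hu) _.
  (* (S6) discards the context [u]; the answer is closed, so it meets the side condition. *)
  apply/rt_step/red_root.
  by have := r_S6 (answer (n i)) u0; rewrite /mshift tren_answer.
move=> u Hn Hu.
have Hs : stage Q u.
  by apply: stage_reds Hu _; apply/stage_start/reduct_Uterm => j jm; exists j.
by have [_ [i im ->] ->] := stage_normal Hs Hn; exists i.
Qed.
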